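(* If $\mu$ is a measure on a doubling metric space $X$, then $$\lim_{q\downarrow 1}\dim_q(\mu,x)\le \underline{\dim}_{\mathrm{loc}}(\mu,x)\le \overline{\dim}_{\mathrm{loc}}(\mu,x)\le \lim_{q\uparrow 1}\dim_q(\mu,x)$$ for $\mu$-almost all $x\in X$.
   Context: Let $(X,d)$ be a metric space. $B(x,r)=\{y\in X: d(x,y)\le r\}$ denotes the closed ball; each ball comes with a fixed centre and radius. $X$ is doubling if there is $N\in\mathbb{N}$ such that every closed ball $B(x,r)$ can be covered by $N$ balls of radius $r/2$. A measure on $X$ means a nontrivial Borel regular outer measure defined on all subsets of $X$ such that bounded sets have finite measure. $\operatorname{spt}(\mu)$ is the smallest closed set of full $\mu$-measure. The upper and lower local dimensions are $\overline{\dim}_{\mathrm{loc}}(\mu,x)=\limsup_{r\downarrow0}\log\mu(B(x,r))/\log r$ and $\underline{\dim}_{\mathrm{loc}}(\mu,x)=\liminf_{r\downarrow0}\log\mu(B(x,r))/\log r$. A $\delta$-packing of a set $A\subset X$ is a countable collection of pairwise disjoint closed balls of radius $\delta$ with centres in $A$. For bounded $A\subset X$ and $q\in\mathbb{R}$ let $S_q(\mu,A,\delta)=\sup\{\sum_{B\in\mathcal{B}}\mu(B)^q : \mathcal{B}\text{ is a }\delta\text{-packing of }A\cap\operatorname{spt}(\mu)\}$ and $\tau_q(\mu,A)=\liminf_{\delta\downarrow0}\frac{\log S_q(\mu,A,\delta)}{\log\delta}$ (values in $[-\infty,\infty]$, with $\log 0=-\infty$, $\log\infty=\infty$). The local $L^q$-spectrum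 is $\tau_q(\mu,x)=\lim_{r\downarrow0}\tau_q(\mu,B(x,r))$, and for $q\ne1$ the local $L^q$-dimension is $\dim_q(\mu,x)=\tau_q(\mu,x)/(q-1)$. *)

(* Defs.v *)
From HB Require Import structures.
From mathcomp Require Import all_boot all_order all_algebra.
From mathcomp Require Import all_classical all_reals all_analysis.

Set Implicit Arguments.
Unset Strict Implicit.
Unset Printing Implicit Defensive.

Import Order.TTheory GRing.Theory Num.Theory.
Import numFieldNormedType.Exports.

Local Open Scope classical_set_scope.
Local Open Scope ring_scope.
Local Open Scope ereal_scope.

Section LocalDimensions.
Context {R : realType} {X : metricType R}.

(* Not the library's [closed_ball], which is the closure of the open ball. *)
Definition cball (x : X) (r : R) : set X := [set y | (mdist x y <= r)%R].

Definition metric_bounded (A : set X) : Prop :=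
  exists M : R, forall x y, A x -> A y -> (mdist x y <= M)%R.

Definition borel_set (A : set X) : Prop := <<s [set U : set X | open U] >> A.

(* Borel regularity: Borel sets are Caratheodory measurable, and every set has
   a Borel hull of the same measure. *)
Definition borel_regular (mu : {outer_measure set X -> \bar R}) : Prop :=
  (forall B, borel_set B -> mu.-caratheodory B) /\
  (forall A, exists B, [/\ borel_set B, A `<=` B & mu B = mu A]).

Definition is_measure (mu : {outer_measure set X -> \bar R}) : Prop :=
  [/\ mu setT != 0, borel_regular mu &
      forall A, metric_bounded A -> mu A < +oo].

Definition spt (mu : set X -> \bar R) : set X :=
  \bigcap_(F in [set F : set X | closed F /\ mu (~` F) = 0]) F.

(* Balls carry their centre and radius, so a packing by balls of radius delta is
   given by the set D of its centres, and two balls with different centres are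
   different members of the packing (hence disjoint). *)
Definition packing (A : set X) (delta : R) (D : set X) : Prop :=
  [/\ countable D, D `<=` A & trivIset D (fun x => cball x delta)].

Definition Sq (mu : set X -> \bar R) (q : R) (A : set X) (delta : R) : \bar R :=
  ereal_sup [set \esum_(x in D) (mu (cball x delta) `^ q)
            | D in packing (A `&` spt mu) delta].

Definition tauq (mu : set X -> \bar R) (q : R) (A : set X) : \bar R :=
  limf_einf (fun delta : R => lne (Sq mu q A delta) * ((ln delta)^-1)%:E)
            (0%R^'+).

(* The limit always exists, since tauq mu q A is antitone in A. *)
Definition loc_tauq (mu : set X -> \bar R) (q : R) (x : X) : \bar R :=
  lim (tauq mu q (cball x r) @[r --> 0%R^'+]).

(* Meaningful for q != 1. *)
Definition loc_dimq (mu : set X -> \bar R) (q : R) (x : X) : \bar R :=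
  loc_tauq mu q x * ((q - 1)^-1)%:E.

Definition upper_dimloc (mu : set X -> \bar R) (x : X) : \bar R :=
  limf_esup (fun r : R => lne (mu (cball x r)) * ((ln r)^-1)%:E) (0%R^'+).

Definition lower_dimloc (mu : set X -> \bar R) (x : X) : \bar R :=
  limf_einf (fun r : R => lne (mu (cball x r)) * ((ln r)^-1)%:E) (0%R^'+).

End LocalDimensions.

Definition doubling (R : realType) (X : metricType R) : Prop :=
  exists N : nat, forall (x : X) (r : R), (0 < r)%R ->
    exists c : 'I_N -> X,
      cball x r `<=` \bigcup_(i in [set: 'I_N]) cball (c i) (r / 2).

(* Main.v *)
Require Import Defs.
From HB Require Import structures.
From mathcomp Require Import all_boot all_order all_algebra.
From mathcomp Require Import all_classical all_reals all_analysis.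
From mathcomp Require Import ring.

Set Implicit Arguments.
Unset Strict Implicit.
Unset Printing Implicit Defensive.

Import Order.TTheory GRing.Theory Num.Theory.
Import numFieldNormedType.Exports.

Local Open Scope classical_set_scope.
Local Open Scope ring_scope.
Local Open Scope ereal_scope.

(** For a fixed [q != 1] the heart of the matter is that almost every [x]
    satisfies [mu (B(x, r))^(q-1) <= r^v] for all small [r], whenever [v] is
    below [loc_tauq mu q x].  Taking the [(q-1)]-th root gives
    [dim_q <= lower_dimloc] when [q > 1], and [upper_dimloc <= dim_q] when
    [q < 1] because the root then reverses the inequality.

    To prove it, localize to a bounded set [A] with [tauq mu q A > v' > v], so
    that [Sq mu q A d <= d^v'] for small [d].  The set [E] of the points of
    [A] in the support where [mu (B(x, d))^(q-1) > d^v] is controlled by one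
    packing: since [X] is doubling, [mu E] is at most a constant times
    [\sum_B mu B] for some [d]-packing of [E] ([bounded_packing]), and on [E]
    one has [mu B = (mu B)^q * (mu B)^(1-q) <= (mu B)^q * d^-v], whence
    [mu E <= K * d^(v'-v)] ([mass_le_Sq]).  This is summable along
    [d = 2^-n], and Borel-Cantelli, which only uses countable subadditivity,
    shows that almost no point is exceptional infinitely often
    ([ae_ball_mass]).  Both signs of [q - 1] are treated at once.

    Countably many triples ([A], [v], [q]) suffice: [A] runs through a
    countable basis, [v] through the rationals, and [q] through [1 +- 1/k],
    because [dim_q] is nonincreasing in [q] on each side of [1].  That
    monotonicity, which also yields both limits, follows from Hoelder's
    inequality between the exponents [q] and [1], using that the measures of
    the balls of a packing of a bounded set have a bounded sum
    ([Sq_interpolation], [loc_dimq_anti_gt1], [loc_dimq_anti_lt1]).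

    All the liminf and limsup computations are replaced by comparison with
    powers of [d] ([lower_exponent_gt], [le_lower_exponent],
    [ge_upper_exponent]); the interpretation of the logarithm at [0] and
    [+oo] is confined to [lne_le_ln] and [ln_le_lne]. *)

(** * Growth exponents and comparison with powers *)

Section PowerLaws.
Context {R : realType}.
Implicit Types (d v : R) (y : \bar R) (M : R -> \bar R).

Lemma lne_le_ln (a : R) y : (0 < a)%R -> (lne y <= (ln a)%:E) = (y <= a%:E).
Proof.
move=> a0; case: y => [r| |] //=; last by rewrite !leNye.
case: ifPn => [r0|]; first by rewrite leNye lee_fin (le_trans r0)// ltW.
by rewrite -ltNge => r0; rewrite !lee_fin ler_ln.
Qed.

Lemma ln_le_lne (a : R) y : (0 < a)%R -> ((ln a)%:E <= lne y) = (a%:E <= y).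
Proof.
move=> a0; case: y => [r| |] //=; last by rewrite !leey.
case: ifPn => [r0|]; first by rewrite leeNy_eq lee_fin leNgt (le_lt_trans r0).
by rewrite -ltNge => r0; rewrite !lee_fin ler_ln.
Qed.

Lemma le_lne_ratio d v y : (0 < d < 1)%R ->
  (v%:E <= lne y * ((ln d)^-1)%:E) = (y <= (d `^ v)%:E).
Proof.
move=> /andP[d0 d1]; rewrite lee_ndivlMr ?ln_lt0 ?d0//.
by rewrite -EFinM -ln_powR lne_le_ln// powR_gt0.
Qed.

Lemma ge_lne_ratio d v y : (0 < d < 1)%R ->
  (lne y * ((ln d)^-1)%:E <= v%:E) = ((d `^ v)%:E <= y).
Proof.
move=> /andP[d0 d1]; rewrite lee_ndivrMr ?ln_lt0 ?d0//.
by rewrite -EFinM -ln_powR ln_le_lne// powR_gt0.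
Qed.

Lemma near_right01 : \forall d \near (0:R)^'+, (0 < d < 1)%R.
Proof.
near=> d; apply/andP; split; near: d; first exact: nbhs_right_gt.
exact: nbhs_right_lt.
Unshelve. all: by end_near. Qed.

Lemma near_const_powR (c e : R) : (0 < c)%R -> (0 < e)%R ->
  \forall d \near (0:R)^'+, (d `^ e <= c)%R.
Proof.
move=> c0 e0; have := powR_cvg0 e0.
move=> /cvgrPdist_le /(_ c c0); apply: filterS => d.
by rewrite sub0r normrN ger0_norm// powR_ge0.
Qed.

(** A constant is dominated by every negative power of [d] as [d] tends to
    [0], so constants never affect an exponent. *)
Lemma near_absorb_const (c v w : R) : (0 < c)%R -> (w < v)%R ->
  \forall d \near (0:R)^'+, (0 < d < 1)%R /\ (c * d `^ v <= d `^ w)%R.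
Proof.
move=> c0 wv; have ic0 : (0 < c^-1)%R by rewrite invr_gt0.
near=> d.
have d01 : (0 < d < 1)%R by near: d; exact: near_right01.
split=> //; case/andP: d01 => d0 d1.
have -> : v = (w + (v - w))%R by rewrite addrC subrK.
rewrite powRD; last by rewrite (gt_eqF d0) implybT.
rewrite mulrCA ger_pMr ?powR_gt0// mulrC -ler_pdivlMr// mul1r.
near: d; apply: near_const_powR => //; rewrite subr_gt0//.
Unshelve. all: by end_near. Qed.

(** [tauq mu q A] and [lower_dimloc mu x] are both convertible to an instance
    of this, as is [upper_dimloc mu x] to one of [upper_exponent]. *)
Definition lower_exponent M : \bar R :=
  limf_einf (fun d : R => lne (M d) * ((ln d)^-1)%:E) (0%R^'+).

Definition upper_exponent M : \bar R :=
  limf_esup (fun d : R => lne (M d) * ((ln d)^-1)%:E) (0%R^'+).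

Lemma lower_exponent_gt M v : v%:E < lower_exponent M ->
  \forall d \near (0:R)^'+, M d <= (d `^ v)%:E.
Proof.
rewrite /lower_exponent limf_einfE => /ereal_sup_gt[_ /= [V FV <-]] vV.
near=> d; rewrite -le_lne_ratio; last by near: d; exact: near_right01.
apply: (le_trans (ltW vV)); apply: ereal_inf_lbound; exists d => //.
by near: d; exact: FV.
Unshelve. all: by end_near. Qed.

(** Together with [lower_exponent_gt] this turns a comparison of lower
    exponents into a comparison with powers up to a constant. *)
Lemma le_lower_exponent M (c v : R) : (0 < c)%R ->
  (\forall d \near (0:R)^'+, M d <= (c * d `^ v)%:E) ->
  v%:E <= lower_exponent M.
Proof.
move=> c0 Mv; apply/lee_subgt0Pr => e e0; rewrite -EFinB.
rewrite /lower_exponent limf_einfE.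
have ev : (v - e < v)%R by rewrite ltrBlDr ltrDl.
pose V := [set d | M d <= (c * d `^ v)%:E /\
  (0 < d < 1)%R /\ (c * d `^ v <= d `^ (v - e))%R].
have FV : (0:R)^'+ V by exact: filterI Mv (near_absorb_const c0 ev).
apply: (@le_trans _ _ (ereal_inf
  ((fun d : R => lne (M d) * ((ln d)^-1)%:E) @` V))); last first.
  by apply: ereal_sup_ubound => /=; exists V.
apply: le_ereal_inf_tmp => _ [d [Md [d01 cd]] <-].
by rewrite le_lne_ratio// (le_trans Md)// lee_fin.
Qed.

Lemma ge_upper_exponent M (c v : R) : (0 < c)%R ->
  (\forall d \near (0:R)^'+, (c * d `^ v)%:E <= M d) ->
  upper_exponent M <= v%:E.
Proof.
move=> c0 Mv; apply/lee_addgt0Pr => e e0; rewrite -EFinD.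
rewrite /upper_exponent limf_esupE.
have ev : (v < v + e)%R by rewrite ltrDl.
have ic0 : (0 < c^-1)%R by rewrite invr_gt0.
pose V := [set d | (c * d `^ v)%:E <= M d /\
  (0 < d < 1)%R /\ (c^-1 * d `^ (v + e) <= d `^ v)%R].
have FV : (0:R)^'+ V by exact: filterI Mv (near_absorb_const ic0 ev).
apply: (@le_trans _ _ (ereal_sup
  ((fun d : R => lne (M d) * ((ln d)^-1)%:E) @` V))).
  by apply: ereal_inf_lbound => /=; exists V.
apply: ge_ereal_sup => _ [d [Md [d01 cd]] <-].
rewrite ge_lne_ratio//; apply: le_trans Md.
by rewrite lee_fin mulrC -ler_pdivrMr// mulrC.
Qed.

Lemma le_lower_upper_exponent M : lower_exponent M <= upper_exponent M.
Proof.
rewrite /lower_exponent /upper_exponent limf_einfE limf_esupE.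
apply: ge_ereal_sup => _ [V FV <-]; apply: le_ereal_inf_tmp => _ [W FW <-].
have [d [Vd Wd]] := filter_ex (filterI FV FW).
apply: (@le_trans _ _ (lne (M d) * ((ln d)^-1)%:E)).
  by apply: ereal_inf_lbound; exists d.
by apply: ereal_sup_ubound; exists d.
Qed.

End PowerLaws.

(** * Dyadic radii *)

Section DyadicRadii.
Context {R : realType}.
Implicit Types (n : nat) (r : R).

Lemma exists_pow2_gt (a : R) : exists k, (a < 2 ^+ k)%R.
Proof.
exists (Num.truncn `|a|).+1; apply: (le_lt_trans (ler_norm a)).
apply: (lt_trans (truncnS_gt _)); rewrite -natrX ltr_nat.
exact: ltn_expl.
Qed.

Definition dyadic n : R := ((2^-1) ^+ n)%R.

Lemma dyadic_gt0 n : (0 < dyadic n)%R.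
Proof. by rewrite exprn_gt0// invr_gt0. Qed.

Lemma dyadicS n : (dyadic n = 2 * dyadic n.+1)%R.
Proof. by rewrite /dyadic exprS mulrA mulfV// mul1r. Qed.

Lemma dyadic_anti m n : (m <= n)%N -> (dyadic n <= dyadic m)%R.
Proof.
move=> mn; rewrite /dyadic ler_iXn2l// ?invr_gt0// ?invf_le1 ?ler1n//.
by rewrite invf_lt1 ?ltr1n.
Qed.

(** The least [m] with [dyadic m < r] is a successor, of the [n] sought. *)
Lemma dyadic_scale n0 r : (0 < r <= dyadic n0)%R ->
  exists2 n, (n0 <= n)%N & (dyadic n.+1 < r <= dyadic n)%R.
Proof.
move=> /andP[r0 rn0].
have ex : exists m, (dyadic m < r)%R.
  have [m mP] := exists_pow2_gt (r^-1)%R; exists m.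
  by rewrite /dyadic exprVn invf_plt ?posrE// exprn_gt0.
have [m mr min_m] := ex_minnP ex.
have n0m : (n0 < m)%N.
  rewrite ltnNge; apply/negP => mn0.
  by have := lt_le_trans mr (le_trans rn0 (dyadic_anti mn0)); rewrite ltxx.
case: m mr min_m n0m => // n mr min_m n0m; exists n => //.
rewrite mr/= leNgt; apply/negP => /min_m; by rewrite ltnn.
Qed.

Lemma near_right0_seq (P : R -> Prop) : (\forall d \near (0:R)^'+, P d) ->
  \forall n \near \oo, P (dyadic n).
Proof.
move=> [e /= e0 eP].
have : geometric 1%R (2^-1 : R) @ \oo --> (0%R : R).
  by apply: cvg_geometric; rewrite ger0_norm ?invf_lt1 ?ltr1n.
move=> /cvgrPdist_lt /(_ e e0); apply: filterS => n /=.
rewrite /geometric/= mul1r => h; exact: eP (dyadic_gt0 n).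
Qed.

End DyadicRadii.

(** * Coverings and packings in doubling spaces *)

Section Covering.
Context {R : realType} {X : metricType R}.
Implicit Types (x y z c : X) (r : R) (s t D : seq X).

Lemma doubling_iter : doubling X -> exists N : nat, forall k x r, (0 < r)%R ->
  exists s, (size s <= N ^ k)%N /\
    cball x r `<=` \bigcup_(c in [set` s]) cball c (r / 2 ^+ k).
Proof.
case=> N dbl; exists N => k x r r0; elim: k => [|k [s [ss sc]]].
  exists [:: x]; split=> // y; rewrite expr0 divr1 => xy.
  by exists x => //=; rewrite inE.
have rk0 : (0 < r / 2 ^+ k)%R by rewrite divr_gt0// exprn_gt0.
have /choice[f fP] : forall c, exists g : 'I_N -> X,
    cball c (r / 2 ^+ k) `<=`
    \bigcup_(i in [set: 'I_N]) cball (g i) (r / 2 ^+ k / 2).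
  by move=> c; exact: dbl.
exists [seq f c i | c <- s, i <- enum 'I_N]; split.
  by rewrite size_allpairs size_enum_ord expnSr leq_mul.
move=> y /sc[c /= cs /fP[i _ yi]]; exists (f c i).
  by apply/allpairsP; exists (c, i); rewrite mem_enum.
by rewrite exprSr invfM mulrA.
Qed.

Lemma le_cball x r r' : (r <= r')%R -> cball x r `<=` cball x r'.
Proof. by move=> rr y xy; exact: le_trans rr. Qed.

Lemma cball_center x r : (0 <= r)%R -> cball x r x.
Proof. by rewrite /cball/= mdistxx. Qed.

Lemma cball_subset x y r r' : (mdist x y + r <= r')%R ->
  cball y r `<=` cball x r'.
Proof.
move=> h z yz; apply: le_trans h.
by apply: (le_trans (metric_triangle x y z)); rewrite lerD2l.
Qed.

Lemma metric_bounded_cball x r : metric_bounded (cball x r).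
Proof.
exists (r + r)%R => y z xy xz; apply: (le_trans (metric_triangle y x z)).
by rewrite lerD// metric_sym.
Qed.

Lemma metric_bounded_sub (A B : set X) : A `<=` B -> metric_bounded B ->
  metric_bounded A.
Proof. by move=> AB [M MB]; exists M => x y /AB Bx /AB By; exact: MB. Qed.

Lemma open_setC_cball x r : open (~` cball x r).
Proof.
rewrite openE => y /negP; rewrite -ltNge => ry.
apply/nbhs_ballP; exists (mdist x y - r)%R; first by rewrite /= subr_gt0.
move=> z; rewrite ballEmdist/= => yz /=; apply/negP; rewrite -ltNge.
rewrite -(ltrD2r (mdist y z)); apply: (lt_le_trans _ (_ : (mdist x y <= _)%R)).
  by rewrite addrC -ltrBrDr.
by rewrite (metric_sym y z); exact: metric_triangle.
Qed.

Context (mu : {outer_measure set X -> \bar R}).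

Lemma outer_measure_seq_cover (I : eqType) (t : seq I) (F : I -> set X)
    (E : set X) :
  E `<=` \bigcup_(c in [set` t]) F c -> mu E <= \sum_(c <- t) mu (F c).
Proof.
elim: t E => [|c t IH] E Et.
  rewrite big_nil; suff -> : E = set0 by rewrite outer_measure0.
  by rewrite -subset0 => x /Et[].
rewrite big_cons; apply: (@le_trans _ _ (mu (F c) + mu (E `\` F c))).
  apply: le_trans (outer_measureU2 mu _ _); apply: le_outer_measure => x Ex.
  by have [] := pselect (F c x); [left|right].
apply: leeD => //; apply: IH => x [Ex nFx].
have [c' /=] := Et x Ex.
by rewrite inE => /orP[/eqP ->//|c't Fx]; exists c'.
Qed.

(** Greedy choice: take [y] in [E] whose ball has nearly the largest measure
    (within a factor 2), remove [cball y (2 * d)] from [E], and repeat.  The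
    removed part is covered by [N] balls of radius [d / 2]; a piece that meets
    [E] lies in a ball of radius [d] centred in [E], whose measure is at most
    [2 * mu (cball y d)].  This replaces a doubling property of [mu], which
    need not hold.  The process stops because each step removes at least one
    ball of the finite cover [s]: the one containing [y] has diameter at most
    [d]. *)
Lemma greedy_packing (N : nat) (d : R) (C : R) :
  (0 < d)%R ->
  (forall y, exists t, (size t <= N)%N /\
     cball y (2 * d) `<=` \bigcup_(c in [set` t]) cball c (d / 2)) ->
  forall n (E : set X) s, (size s <= n)%N ->
  E `<=` \bigcup_(c in [set` s]) cball c (d / 2) ->
  (forall x, E x -> mu (cball x d) <= C%:E) ->
  exists D, [/\ uniq D, [set` D] `<=` E, trivIset [set` D] (fun x => cball x d)
    & mu E <= (2 * N)%:R%:E * \sum_(y <- D) mu (cball y d)].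
Proof.
move=> d0 dbl; elim=> [|n IH] E s sn Es EC.
  exists [::]; split=> //.
  suff -> : E = set0 by rewrite outer_measure0 big_nil mule0.
  by rewrite -subset0 => x /Es[c]; case: s sn {Es}.
have [->|/set0P[y0 Ey0]] := eqVneq E set0.
  by exists [::]; split=> //; rewrite outer_measure0 big_nil mule0.
pose M := ereal_sup [set mu (cball x d) | x in E].
have MC : M <= C%:E by apply: ge_ereal_sup => _ [x Ex <-]; exact: EC.
have M0 : 0 <= M.
  apply: (le_trans (outer_measure_ge0 mu (cball y0 d))).
  by apply: ereal_sup_ubound; exists y0.
have Mfin : M \is a fin_num.
  by rewrite ge0_fin_numE// (le_lt_trans MC)// ltry.
have [y Ey My] : exists2 y, E y & M <= 2%:E * mu (cball y d).
  have [M00|Mn0] := eqVneq M 0.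
    by exists y0 => //; rewrite M00 mule_ge0// outer_measure_ge0.
  have M00 : 0 < M by rewrite lt_neqAle eq_sym Mn0.
  have : (2^-1)%:E * M < M.
    rewrite -(fineK Mfin) -EFinM lte_fin gtr_pMl ?invf_lt1 ?ltr1n//.
    by rewrite fine_gt0// M00/= -ge0_fin_numE.
  move=> /ereal_sup_gt[_ [y Ey <-] /ltW yM]; exists y => //.
  have := @lee_wpmul2l _ 2%:E _ _ _ yM.
  by rewrite muleA -EFinM mulfV// mul1e; apply; rewrite lee_fin.
have [c cs yc] := Es y Ey.
pose E' := E `\` cball y (2 * d).
have [D [uD DE' tD muD]] : exists D,
    [/\ uniq D, [set` D] `<=` E', trivIset [set` D] (fun x => cball x d)
    & mu E' <= (2 * N)%:R%:E * \sum_(y <- D) mu (cball y d)].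
  apply: (IH E' [seq c' <- s | c' != c]).
  - rewrite -ltnS (leq_trans _ sn)// size_filter ltn_neqAle count_size andbT.
    by rewrite -all_count; apply/allPn; exists c => //=; rewrite eqxx.
  - move=> z [Ez yz]; have [c' c's zc'] := Es z Ez.
    exists c' => //=; rewrite mem_filter; apply/andP; split => //.
    apply: contra_notN yz => /eqP c'c; rewrite c'c in zc'.
    apply: (@le_cball y d); first by rewrite ler_peMl ?ler1n ?ltW.
    apply: (le_trans (metric_triangle y c z)).
    by rewrite [leRHS](splitr d) lerD// metric_sym.
  - by move=> x [Ex _]; exact: EC.
have yD : y \notin D.
  apply/negP => /DE'[_]; apply; apply: cball_center.
  by rewrite mulr_ge0// ltW.
have yz_disj z : z \in D -> cball y d `&` cball z d !=set0 -> False.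
  move=> /DE'[_ nyz] [w [yw zw]]; apply: nyz.
  apply: (le_trans (metric_triangle y w z)).
  by rewrite mulr_natl mulr2n lerD// metric_sym.
exists (y :: D); split.
- by rewrite /= yD.
- by move=> z /=; rewrite inE => /orP[/eqP ->//|/DE'[]].
- move=> a b /=; rewrite !inE => /orP[/eqP ->|aD] /orP[/eqP ->|bD] // ab.
  + by case: (yz_disj b).
  + by case: (yz_disj a) => //; rewrite setIC.
  + exact: tD.
- rewrite big_cons ge0_muleDr; last 2 first.
  + exact: outer_measure_ge0.
  + by apply: sume_ge0 => *; exact: outer_measure_ge0.
  apply: (@le_trans _ _ (mu (E `&` cball y (2 * d)) + mu E')).
    exact: le_outer_measureIC.
  apply: leeD => //.
  have [t [tN yt]] := dbl y.
  apply: (@le_trans _ _ (\sum_(c <- t) mu (E `&` cball c (d / 2)))).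
    apply: outer_measure_seq_cover => z [Ez /yt[c' c't c'z]].
    by exists c'.
  apply: (@le_trans _ _ (\sum_(c <- t) M)).
    apply: lee_sum => c' _.
    have [->|/set0P[z [Ez c'z]]] := eqVneq (E `&` cball c' (d / 2)) set0.
      by rewrite outer_measure0.
    apply: (@le_trans _ _ (mu (cball z d))); last first.
      by apply: ereal_sup_ubound; exists z.
    apply: le_outer_measure => w [_ c'w].
    apply: (le_trans (metric_triangle z c' w)).
    by rewrite (splitr d) lerD// metric_sym.
  have -> : \sum_(c <- t) M = (size t)%:R%:E * M.
    rewrite big_const_seq count_predT.
    elim: (size t) => [|m IHm] /=; first by rewrite mul0e.
    rewrite IHm -[m.+1]addn1 natrD EFinD ge0_muleDl ?lee_fin//.
    by rewrite mul1e addeC.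
  apply: (@le_trans _ _ (N%:R%:E * M)).
    by apply: lee_wpmul2r => //; rewrite lee_fin ler_nat.
  rewrite natrM EFinM -muleA muleCA; exact: lee_wpmul2l.
Qed.

End Covering.

(** * Measures, supports and packing sums *)

Section SupportAndPackings.
Context {R : realType} {X : metricType R}
  (mu : {outer_measure set X -> \bar R}) (mu_meas : is_measure mu).
Implicit Types (x y z c : X) (r d : R) (s t D : seq X) (A E : set X).

Lemma caratheodory_cball x r : mu.-caratheodory (cball x r).
Proof.
rewrite -[cball x r]setCK; apply: caratheodory_measurable_setC.
case: mu_meas => _ [bm _] _; apply: bm; apply: sub_sigma_algebra.
exact: open_setC_cball.
Qed.

Lemma bounded_fin_num A : metric_bounded A -> mu A \is a fin_num.
Proof.
by case: mu_meas => _ _ bm /bm ?; rewrite ge0_fin_numE// outer_measure_ge0.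
Qed.

Lemma cball_fin_num x r : mu (cball x r) \is a fin_num.
Proof. exact/bounded_fin_num/metric_bounded_cball. Qed.

(** Closed balls are Caratheodory measurable, so they can be split off [A] one
    by one. *)
Lemma sum_disjoint_cball D r A : uniq D ->
  trivIset [set` D] (fun x => cball x r) ->
  \bigcup_(y in [set` D]) cball y r `<=` A ->
  \sum_(y <- D) mu (cball y r) <= mu A.
Proof.
elim: D A => [|y D IH] A /=.
  by rewrite big_nil outer_measure_ge0.
move=> /andP[yD uD] tD DA; rewrite big_cons (caratheodory_cball y r A).
apply: leeD.
  by apply: le_outer_measure => z yz; split=> //; apply: DA; exists y => //=;
    rewrite inE eqxx.
apply: IH => //.
  apply: sub_trivIset tD => z /= zD; by rewrite inE zD orbT.
move=> z [w /= wD wz]; split.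
  by apply: DA; exists w => //=; rewrite inE wD orbT.
move=> yz; have wy : w = y.
  apply: tD; rewrite /= ?inE ?eqxx ?wD ?orbT//.
  by exists z.
by rewrite -wy wD in yD.
Qed.

(** Otherwise the complement of the open ball would be a closed set of full
    measure missing [x]. *)
Lemma spt_cball_gt0 x r : (0 < r)%R -> spt mu x -> 0 < mu (cball x r).
Proof.
move=> r0 sx; rewrite lt_neqAle outer_measure_ge0 andbT eq_sym.
apply/eqP => m0; pose F := ~` (ball x r).
have : F x.
  apply: sx; split; last first.
    apply/eqP; rewrite eq_le outer_measure_ge0 andbT -m0 setCK.
    by apply: le_outer_measure => y; rewrite ballEmdist/= => /ltW.
  apply: open_closedC; rewrite openE => y.
  rewrite ballEmdist/= => xy; apply/nbhs_ballP.
  exists (r - mdist x y)%R; first by rewrite /= subr_gt0.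
  move=> z; rewrite !ballEmdist/= => yz.
  by apply: (le_lt_trans (metric_triangle x y z)); rewrite addrC -ltrBrDr.
by rewrite /F; apply; exact: ballxx.
Qed.

Lemma null_bigcup_countable (I : countType) (F : I -> set X) :
  (forall i, mu (F i) = 0) -> mu (\bigcup_i F i) = 0.
Proof.
move=> F0; pose G n := if @unpickle I n is Some i then F i else set0.
apply/eqP; rewrite eq_le outer_measure_ge0 andbT.
apply: (@le_trans _ _ (mu (\bigcup_n G n))).
  apply: le_outer_measure => x [i _ Fx]; exists (pickle i) => //.
  by rewrite /G pickleK.
apply: (le_trans (outer_measure_sigma_subadditive mu G)).
rewrite eseries0// => n _ _; rewrite /G.
by case: unpickle => [i|]; rewrite ?F0 ?outer_measure0.
Qed.

Lemma null_sub A E : A `<=` E -> mu E = 0 -> mu A = 0.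
Proof.
move=> AE E0; apply/eqP; rewrite eq_le outer_measure_ge0 andbT -E0.
exact: le_outer_measure.
Qed.

Lemma null_setU A E : mu A = 0 -> mu E = 0 -> mu (A `|` E) = 0.
Proof.
move=> A0 E0; apply/eqP; rewrite eq_le outer_measure_ge0 andbT.
by rewrite -(adde0 0) -{1}A0 -E0; exact: outer_measureU2.
Qed.

(** Covering the balls of integer radius around one point at each scale gives
    countably many centres, dense in [X]; the last index fixes the radius. *)
Lemma doubling_countable_basis : doubling X ->
  exists B : nat * nat * nat * nat -> set X,
    (forall i, metric_bounded (B i)) /\
    forall x r, (0 < r)%R ->
      exists2 i, B i x & B i `<=` [set y | (mdist x y < r)%R].
Proof.
move=> /doubling_iter[N dbl].
have [[x0 _]|X0] := pselect ([set: X] !=set0); last first.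
  by exists (fun=> set0); split=> [i|x]; [exists 0%R|case: X0; exists x].
have /choice[f fP] : forall nk : nat * nat, exists s,
    cball x0 nk.1.+1%:R `<=`
      \bigcup_(c in [set` s]) cball c (nk.1.+1%:R / 2 ^+ nk.2).
  move=> [n k]; have [|s [_ sP]] := dbl k x0 n.+1%:R; last by exists s.
  by rewrite ltr0n.
exists (fun i => cball (nth x0 (f i.1.1) i.1.2) i.2.+1%:R^-1).
split=> [i|x r r0]; first exact: metric_bounded_cball.
pose m := Num.truncn (2 / r); pose e : R := m.+1%:R^-1%R.
have e0 : (0 < e)%R by rewrite invr_gt0 ltr0n.
have er : (e + e < r)%R.
  have : (2 / r < m.+1%:R)%R by exact: truncnS_gt.
  rewrite ltr_pdivrMr// mulrC -ltr_pdivrMr ?ltr0n//.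
  by rewrite mulr_natl mulr2n.
pose n := Num.truncn (mdist x0 x).
have [k kP] := exists_pow2_gt (n.+1%:R / e).
have : cball x0 n.+1%:R x by apply: ltW; exact: truncnS_gt.
move=> /(fP (n, k))[c /= cs cx].
have {}cx : cball c e x.
  apply: le_cball cx; rewrite ler_pdivrMr ?exprn_gt0//.
  by rewrite mulrC -ler_pdivrMr// ltW.
exists (n, k, index c (f (n, k)), m); rewrite /= nth_index// => y cy.
apply: le_lt_trans er; apply: (le_trans (metric_triangle x c y)).
by rewrite lerD// metric_sym.
Qed.

(** The complement of the support is covered by the null sets of a countable
    basis. *)
Lemma spt_full_measure : doubling X -> mu (~` spt mu) = 0.
Proof.
move=> /doubling_countable_basis[B [_ Bx]].
pose F i := if pselect (mu (B i) = 0) is left _ then B i else set0.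
apply: (@null_sub _ (\bigcup_i F i)); last first.
  apply: null_bigcup_countable => i; rewrite /F.
  by case: pselect => // _; exact: outer_measure0.
move=> x nsx.
have [C [clC C0] nCx] : exists2 C : set X, closed C /\ mu (~` C) = 0 & ~ C x.
  apply: contrapT => h; apply: nsx => C Ch; apply: contrapT => nCx.
  by apply: h; exists C.
have : nbhs x (~` C) by apply: open_nbhs_nbhs; split => //; exact: closed_openC.
move=> /nbhs_ballP[e /= e0 eC]; have [i Bix Bie] := Bx x e e0.
exists i => //; rewrite /F; case: pselect => // nB; exfalso; apply: nB.
by apply: null_sub C0 => y /Bie xy; apply: eC; rewrite ballEmdist.
Qed.

(** Finite packings as duplicate-free sequences of centres, which allow
    induction; they suffice because the sums in [Sq] are suprema of finite
    ones ([Sq_le], [sum_le_Sq]). *)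
Definition fpacking A d D :=
  [/\ uniq D, [set` D] `<=` A & trivIset [set` D] (fun x => cball x d)].

(** The constant of [greedy_packing] depends on the doubling constant only,
    since [cball y (2 * d)] is covered by [N ^ 2] balls of radius [d / 2];
    boundedness of [E] provides the finite cover and the finite measures. *)
Lemma bounded_packing : doubling X -> exists2 K : R, (0 < K)%R &
  forall d E, (0 < d)%R -> metric_bounded E ->
  exists2 D, fpacking E d D & mu E <= K%:E * \sum_(y <- D) mu (cball y d).
Proof.
move=> /doubling_iter[N dbl].
exists (2 * N ^ 2).+1%:R; first by rewrite ltr0n.
move=> d E d0 [M EM].
have [->|/set0P[x0 Ex0]] := eqVneq E set0.
  exists [::]; first by split.
  by rewrite outer_measure0 big_nil mule0.
pose M' : R := Num.max M 1%R.
have M'0 : (0 < M')%R by rewrite lt_max ltr01 orbT.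
have [k kP] := exists_pow2_gt (M' / (d / 2)).
have [s [_ sP]] := dbl k x0 M' M'0.
have Es : E `<=` \bigcup_(c in [set` s]) cball c (d / 2).
  move=> x Ex; have [|c cs cx] := sP x.
    by rewrite /cball/= /M' le_max EM.
  exists c => //; apply: le_cball cx.
  rewrite ler_pdivrMr ?exprn_gt0// mulrC -ler_pdivrMr ?divr_gt0//.
  exact: ltW.
have EC x : E x -> mu (cball x d) <= (fine (mu (cball x0 (M + d))))%:E.
  move=> Ex; rewrite fineK ?cball_fin_num//; apply: le_outer_measure.
  by apply: cball_subset; rewrite lerD2r EM.
have dbl2 y : exists t, (size t <= N ^ 2)%N /\
    cball y (2 * d) `<=` \bigcup_(c in [set` t]) cball c (d / 2).
  have [|t tP] := dbl 2%N y (2 * d)%R; first by rewrite mulr_gt0.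
  exists t; suff -> : (d / 2 = 2 * d / 2 ^+ 2)%R by [].
  by field.
have [D [uD DE tD muD]] := greedy_packing d0 dbl2 (leqnn _) Es EC.
exists D => //; apply: (le_trans muD); apply: lee_wpmul2r.
  by apply: sume_ge0 => *; exact: outer_measure_ge0.
by rewrite lee_fin ler_nat.
Qed.

Lemma sum_le_Sq q A d D : fpacking (A `&` spt mu) d D ->
  \sum_(y <- D) (mu (cball y d) `^ q) <= Sq mu q A d.
Proof.
move=> [uD DA tD]; apply: ereal_sup_ubound => /=; exists [set` D].
  by split => //; exact: finite_set_countable.
rewrite esum_fset; first by rewrite -fsbig_seq.
- exact: finite_seq.
- by move=> *; exact: poweR_ge0.
Qed.

Lemma Sq_le q A d (c : \bar R) :
  (forall D, fpacking (A `&` spt mu) d D ->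
    \sum_(y <- D) (mu (cball y d) `^ q) <= c) -> Sq mu q A d <= c.
Proof.
move=> h; apply: ge_ereal_sup => _ [D [cD DA tD] <-].
apply: ge_ereal_sup => _ [F [finF FD] <-].
rewrite fsbig_finite//; apply: h; split.
- exact: finmap.fset_uniq.
- by rewrite fset_setK//; exact: subset_trans DA.
- by rewrite fset_setK//; exact: sub_trivIset tD.
Qed.

Lemma Sq_mono q A A' d : A `<=` A' -> Sq mu q A d <= Sq mu q A' d.
Proof.
move=> AA'; apply: Sq_le => D [uD DA tD]; apply: sum_le_Sq; split => //.
by apply: subset_trans DA _; exact: setSI.
Qed.

End SupportAndPackings.

(** * Interpolation of packing sums and exceptional sets *)

Section MassOfExceptionalSets.
Context {R : realType} {X : metricType R}
  (mu : {outer_measure set X -> \bar R}) (mu_meas : is_measure mu).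
Implicit Types (x y z c : X) (r d : R) (s t D : seq X) (A E : set X).

Definition ball_mass x r : R := fine (mu (cball x r)).

Lemma ball_massE x r : mu (cball x r) = (ball_mass x r)%:E.
Proof. by rewrite /ball_mass fineK// cball_fin_num. Qed.

Lemma ball_mass_gt0 x r : (0 < r)%R -> spt mu x -> (0 < ball_mass x r)%R.
Proof. by move=> r0 sx; rewrite -lte_fin -ball_massE spt_cball_gt0. Qed.

Lemma sum_poweRE q d D : \sum_(y <- D) (mu (cball y d) `^ q) =
  (\sum_(y <- D) ball_mass y d `^ q)%R%:E.
Proof.
by rewrite -sumEFin; apply: eq_bigr => y _; rewrite ball_massE poweR_EFin.
Qed.

Lemma sum_cballE d D : \sum_(y <- D) mu (cball y d) =
  (\sum_(y <- D) ball_mass y d)%R%:E.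
Proof. by rewrite -sumEFin; apply: eq_bigr => y _; rewrite ball_massE. Qed.

(** A pointwise form of Hoelder's inequality: writing [u = a^(q-1)], it is
    [u^th <= K^th * (1 + u / K)], clear from [w^th <= 1 + w] for
    [w = u / K]. *)
Lemma powR_interpolation (a K q q' th : R) : (0 < a)%R -> (0 < K)%R ->
  (0 <= th <= 1)%R -> (q' - 1 = th * (q - 1))%R ->
  (a `^ q' <= K `^ th * (a + a `^ q / K))%R.
Proof.
move=> a0 K0 /andP[th0 th1] qq.
have apow p : (a `^ p = a * a `^ (p - 1))%R.
  rewrite -{2}(powRr1 (ltW a0)) -powRD ?(gt_eqF a0) ?implybT//.
  by congr powR; ring.
rewrite (apow q') (apow q) qq mulrC powRrM powRAC.
set u := (a `^ (q - 1))%R; have u0 : (0 < u)%R by exact: powR_gt0.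
suff H : ((u / K) `^ th <= 1 + u / K)%R.
  have -> : (K `^ th * (a + a * u / K) = (K `^ th * (1 + u / K)) * a)%R by ring.
  rewrite ler_pM2r// -{1}(mulfVK (lt0r_neq0 K0) u) powRM ?(ltW K0)//.
    by rewrite mulrC ler_pM2l// powR_gt0.
  by rewrite ltW// divr_gt0.
have w0 : (0 < u / K)%R by rewrite divr_gt0.
have [w1|w1] := leP (u / K)%R 1%R.
  apply: (@le_trans _ _ (1 `^ th)%R); last by rewrite powR1 lerDl ltW.
  by apply: ge0_ler_powR => //; rewrite nnegrE ltW.
apply: (@le_trans _ _ (u / K)%R); last by rewrite lerDr.
by apply: ler1_powR => //; exact: ltW.
Qed.

(** Sum [powR_interpolation] over a packing, with the same [K] for all of its
    balls: the terms [a] add up to at most [C], and the terms [a^q / K] to at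
    most [1]. *)
Lemma Sq_interpolation q q' th A d (K C : R) : (0 < d)%R -> (0 < K)%R ->
  (0 <= th <= 1)%R -> (q' - 1 = th * (q - 1))%R ->
  (forall D, fpacking (A `&` spt mu) d D ->
    \sum_(y <- D) mu (cball y d) <= C%:E) ->
  Sq mu q A d <= K%:E ->
  Sq mu q' A d <= ((C + 1) * K `^ th)%:E.
Proof.
move=> d0 K0 th01 qq DC SK; apply: Sq_le => D pD.
have := DC D pD; rewrite sum_cballE lee_fin => sC.
have := le_trans (sum_le_Sq q pD) SK; rewrite sum_poweRE lee_fin => sK.
rewrite sum_poweRE lee_fin.
apply: (@le_trans _ _ (\sum_(y <- D)
    (K `^ th * (ball_mass y d + ball_mass y d `^ q / K)))%R).
  rewrite big_seq [leRHS]big_seq; apply: ler_sum => y yD.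
  apply: powR_interpolation => //; apply: ball_mass_gt0 => //.
  by case: pD => _ /(_ y yD)[].
rewrite -mulr_sumr big_split/= -mulr_suml mulrC.
apply: ler_wpM2r; first exact: powR_ge0.
by rewrite lerD// ler_pdivrMr// mul1r.
Qed.

(** Apply [bounded_packing] to [E] and write
    [mu B = (mu B)^(1-q) * (mu B)^q]: the first factor is at most [b] at
    centres in [E], and the second ones sum up to at most [Sq mu q A d]. *)
Lemma mass_le_Sq : doubling X -> exists2 K : R, (0 < K)%R &
  forall q (b c d : R) A E, (0 < d)%R -> (0 <= b)%R ->
  metric_bounded A -> E `<=` A `&` spt mu ->
  (forall x, E x -> (ball_mass x d `^ (1 - q) <= b)%R) ->
  Sq mu q A d <= c%:E ->
  mu E <= (K * (b * c))%:E.
Proof.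
move=> /(bounded_packing mu_meas)[K K0 Kpack]; exists K => //.
move=> q b c d A E d0 b0 bA EA Eb Sc.
have bE : metric_bounded E by apply: metric_bounded_sub bA => x /EA[].
have [D [uD DE tD] muE] := Kpack d E d0 bE.
apply: (le_trans muE); rewrite EFinM; apply: lee_wpmul2l.
  by rewrite lee_fin ltW.
have pD : fpacking (A `&` spt mu) d D.
  by split => //; exact: subset_trans EA.
have := le_trans (sum_le_Sq q pD) Sc; rewrite sum_poweRE lee_fin => sc.
rewrite sum_cballE lee_fin; apply: (le_trans _ (ler_wpM2l b0 sc)).
rewrite mulr_sumr big_seq [leRHS]big_seq; apply: ler_sum => y yD.
have Ey := DE y yD; have [_ sy] := EA y Ey.
have a0 := ball_mass_gt0 d0 sy.
rewrite [leLHS](_ : _ = (ball_mass y d `^ (1 - q) * ball_mass y d `^ q)%R).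
  by apply: ler_wpM2r; [exact: powR_ge0|exact: Eb].
by rewrite -powRD ?(gt_eqF a0) ?implybT// subrK powRr1// ltW.
Qed.

(** The Borel-Cantelli lemma for geometric bounds; it needs only countable
    subadditivity, so the sets [E n] may be nonmeasurable. *)
Lemma null_limsup (E : nat -> set X) (n0 : nat) (K rho : R) : (0 <= K)%R ->
  (0 < rho < 1)%R ->
  (forall n, (n0 <= n)%N -> mu (E n) <= (K * rho ^+ n)%:E) ->
  mu [set x | ~ \forall n \near \oo, ~ E n x] = 0.
Proof.
move=> K0 /andP[r0 r1] En.
set Z := (X in mu X); apply/eqP; rewrite eq_le outer_measure_ge0 andbT.
have r10 : (0 < 1 - rho)%R by rewrite subr_gt0.
have ZN N : (n0 <= N)%N -> mu Z <= (K / (1 - rho) * rho ^+ N)%:E.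
  move=> nN; apply: (@le_trans _ _ (mu (\bigcup_i E (N + i)%N))).
    apply: le_outer_measure => x Zx; apply: contrapT => nx; apply: Zx.
    exists N => // n /= Nn Enx; apply: nx; exists (n - N)%N => //.
    by rewrite subnKC.
  apply: (le_trans (outer_measure_sigma_subadditive mu _)).
  apply: lime_le.
    by apply: is_cvg_nneseries => *; exact: outer_measure_ge0.
  apply: nearW => m; rewrite big_mkord.
  apply: (@le_trans _ _ (\sum_(i < m) (K * rho ^+ N * rho ^+ i)%:E)).
    apply: lee_sum => i _; rewrite -mulrA -exprD; apply: En.
    by rewrite (leq_trans nN)// leq_addr.
  rewrite sumEFin lee_fin -mulr_sumr.
  have -> : (K / (1 - rho) * rho ^+ N = K * rho ^+ N * (1 - rho)^-1)%R by ring.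
  apply: ler_wpM2l; first by rewrite mulr_ge0// exprn_ge0// ltW.
  have -> : (\sum_(i < m) rho ^+ i = (1 - rho ^+ m) / (1 - rho))%R.
    rewrite -[(1 - rho ^+ m)%R]opprB subrX1 -mulNr opprB mulrC.
    by rewrite mulKf// lt0r_neq0.
  by rewrite ler_pdivrMr// mulVf ?lt0r_neq0// gerBl exprn_ge0// ltW.
apply/lee_addgt0Pr => e e0; rewrite add0e.
have : geometric (K / (1 - rho)) rho @ \oo --> (0%R : R).
  by apply: cvg_geometric; rewrite ger0_norm ?ltW.
move=> /cvgrPdist_le /(_ e e0)[N _ NP].
apply: (le_trans (ZN (maxn n0 N) (leq_maxl _ _))); rewrite lee_fin.
apply: le_trans (NP (maxn n0 N) (leq_maxr _ _)).
by rewrite sub0r normrN /geometric/= ler_norm.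
Qed.

(** With [v < v' < tauq mu q A], [mass_le_Sq] bounds the exceptional set at
    scale [2^-n] by a multiple of [2^-(n (v' - v))], which is summable. *)
Lemma ae_ball_mass (q v : R) A : doubling X -> metric_bounded A ->
  v%:E < tauq mu q A ->
  mu [set x | (A `&` spt mu) x /\ ~ \forall n \near \oo,
    (ball_mass x (dyadic n) `^ (q - 1) <= (dyadic n) `^ v)%R] = 0.
Proof.
move=> dbl bA vt.
have [v' vv' v't] : exists2 v' : R, (v < v')%R & v'%:E < tauq mu q A.
  move: vt; case: (tauq mu q A) => [r| |] //.
    rewrite lte_fin => vr; exists ((v + r) / 2)%R; first by rewrite midf_lt.
    by rewrite lte_fin midf_lt.
  by move=> _; exists (v + 1)%R; rewrite ?ltrDl// ltry.
have [K K0 EK] := mass_le_Sq dbl.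
have h0 := @dyadic_gt0 R.
have [n0 _ n0P] : \forall n \near \oo, Sq mu q A (dyadic n) <= (dyadic n `^ v')%:E.
  by apply: (near_right0_seq (lower_exponent_gt v't)).
pose E n := [set x | (A `&` spt mu) x /\
  ~ (ball_mass x (dyadic n) `^ (q - 1) <= dyadic n `^ v)%R].
have vv0 : (0 < v' - v)%R by rewrite subr_gt0.
have hlt1 : (2^-1 < 1 :> R)%R by rewrite invf_lt1 ?ltr1n.
pose rho : R := ((2^-1) `^ (v' - v))%R.
apply: (@null_sub _ _ mu _ [set x | ~ \forall n \near \oo, ~ E n x]).
  move=> x [Ax nx] nE; apply: nx; apply: filterS nE => n nEn.
  by apply: contrapT => nb; apply: nEn; split.
apply: (@null_limsup E n0 K rho); first exact: ltW.
  rewrite powR_gt0//= ?invr_gt0//.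
  have <- : (1 `^ (v' - v) = 1 :> R)%R by rewrite powR1.
  by apply: gt0_ltr_powR => //; rewrite nnegrE ?invr_ge0.
move=> n nn0.
have -> : (rho ^+ n = dyadic n `^ (- v) * dyadic n `^ v')%R.
  rewrite -powRD ?(gt_eqF (h0 n)) ?implybT// addrC.
  by rewrite /rho -powR_mulrn ?powR_ge0// powRAC powR_mulrn.
apply: (EK q _ _ (dyadic n) A) => //.
- exact: powR_ge0.
- by move=> x [].
- move=> x [[_ sx] /negP]; rewrite -ltNge => hx.
  have a0 : (0 < ball_mass x (dyadic n))%R by exact: ball_mass_gt0.
  rewrite -opprB !powRN lef_pV2 ?posrE ?powR_gt0//; exact: ltW.
- exact: n0P.
Qed.

End MassOfExceptionalSets.

(** * From dyadic to arbitrary radii *)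

Section PowersOfComparableRadii.
Context {R : realType}.
Implicit Types (s t w : R).

(** The factor [2 ^ |w|] covers both signs of [w] and both directions. *)
Lemma powR_le_double s t w : (0 < s)%R -> (s <= t <= 2 * s)%R ->
  (t `^ w <= 2 `^ `|w| * s `^ w)%R /\ (s `^ w <= 2 `^ `|w| * t `^ w)%R.
Proof.
move=> s0 /andP[st ts]; have t0 : (0 < t)%R by exact: lt_le_trans st.
have u1 : (1 <= t / s)%R by rewrite ler_pdivlMr// mul1r.
have u2 : (t / s <= 2)%R by rewrite ler_pdivrMr.
have u0 : (0 < t / s)%R by rewrite divr_gt0.
have bnd (w' : R) : (`|w'| = `|w| -> (t / s) `^ w' <= 2 `^ `|w|)%R.
  move=> ww; apply: (@le_trans _ _ ((t / s) `^ `|w'|)%R).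
    by apply: ler_powR => //; exact: ler_norm.
  by rewrite ww; apply: ge0_ler_powR => //; rewrite nnegrE ltW.
split.
  rewrite -{1}(mulfVK (lt0r_neq0 s0) t) powRM ?(ltW u0) ?(ltW s0)//.
  by apply: ler_wpM2r; [exact: powR_ge0|exact: bnd].
have -> : s = (t * (t / s)^-1)%R.
  by rewrite invf_div mulrC mulfVK// lt0r_neq0.
rewrite powRM ?invr_ge0 ?(ltW t0) ?(ltW u0)// mulrC.
apply: ler_wpM2r; first exact: powR_ge0.
rewrite -powR_inv1 ?(ltW u0)// -powRrM; apply: bnd.
by rewrite mulN1r normrN.
Qed.

End PowersOfComparableRadii.

Section LocalDimensionBounds.
Context {R : realType} {X : metricType R}
  (mu : {outer_measure set X -> \bar R}) (mu_meas : is_measure mu).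
Implicit Types (x y : X) (q v r : R).

Local Notation mass := (ball_mass mu).

Lemma le_ball_mass x r s : (r <= s)%R -> (mass x r <= mass x s)%R.
Proof.
move=> rs; rewrite -lee_fin -!ball_massE//; apply: le_outer_measure.
exact: le_cball.
Qed.

(** Enlarge the ball of radius [r] to the next dyadic radius: the root of
    positive order [q - 1] preserves the upper bound on its measure. *)
Lemma le_lower_dimloc q v x : (1 < q)%R -> spt mu x ->
  (\forall n \near \oo, (mass x (dyadic n) `^ (q - 1) <= dyadic n `^ v)%R) ->
  (v / (q - 1))%:E <= lower_dimloc mu x.
Proof.
move=> q1 sx [n0 _ n0P]; have p0 : (0 < q - 1)%R by rewrite subr_gt0.
set w := (v / (q - 1))%R.
apply: (@le_lower_exponent _ _ (2 `^ `|w|)%R); first by rewrite powR_gt0.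
near=> r.
have r0 : (0 < r)%R by near: r; exact: nbhs_right_gt.
have [n nn0 /andP[nr rn]] : exists2 n, (n0 <= n)%N & (dyadic n.+1 < r <= dyadic n)%R.
  apply: dyadic_scale; rewrite r0/=; near: r; apply: nbhs_right_le.
  exact: dyadic_gt0.
rewrite ball_massE// lee_fin; apply: (le_trans (le_ball_mass x rn)).
have a0 := ball_mass_gt0 mu_meas (dyadic_gt0 n) sx.
apply: (@le_trans _ _ (dyadic n `^ w)%R).
  have -> : mass x (dyadic n) = ((mass x (dyadic n) `^ (q - 1)) `^ (q - 1)^-1)%R.
    by rewrite -powRrM mulfV ?powRr1 ?lt0r_neq0// ltW.
  rewrite /w powRrM; apply: ge0_ler_powR; rewrite ?nnegrE ?powR_ge0//.
    by rewrite invr_ge0 ltW.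
  exact: n0P.
apply: (powR_le_double _ r0 _).1; rewrite rn dyadicS ler_pM2l//; exact: ltW.
Unshelve. all: by end_near. Qed.

(** Here [q - 1 < 0], so the hypothesis bounds the measure from below and the
    ball is shrunk to the previous dyadic radius. *)
Lemma upper_dimloc_le q v x : (q < 1)%R -> spt mu x ->
  (\forall n \near \oo, (mass x (dyadic n) `^ (q - 1) <= dyadic n `^ v)%R) ->
  upper_dimloc mu x <= (v / (q - 1))%:E.
Proof.
move=> q1 sx [n0 _ n0P]; have p0 : (0 < 1 - q)%R by rewrite subr_gt0.
set w := (v / (q - 1))%R.
have c0 : (0 < 2 `^ `|w| :> R)%R by rewrite powR_gt0.
apply: (@ge_upper_exponent _ _ (2 `^ `|w|)^-1%R); first by rewrite invr_gt0.
near=> r.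
have r0 : (0 < r)%R by near: r; exact: nbhs_right_gt.
have [n nn0 /andP[nr rn]] : exists2 n, (n0 <= n)%N & (dyadic n.+1 < r <= dyadic n)%R.
  apply: dyadic_scale; rewrite r0/=; near: r; apply: nbhs_right_le.
  exact: dyadic_gt0.
rewrite ball_massE// lee_fin; apply: (le_trans _ (le_ball_mass x (ltW nr))).
have a0 := ball_mass_gt0 mu_meas (dyadic_gt0 n.+1) sx.
have d0 := dyadic_gt0 (R := R) n.+1.
apply: (@le_trans _ _ (dyadic n.+1 `^ w)%R).
  rewrite mulrC ler_pdivrMr// mulrC.
  by apply: (powR_le_double _ d0 _).1; rewrite (ltW nr)/= -dyadicS.
have -> : mass x (dyadic n.+1) =
    ((mass x (dyadic n.+1) `^ (1 - q)) `^ (1 - q)^-1)%R.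
  by rewrite -powRrM mulfV ?powRr1 ?lt0r_neq0// ltW.
have -> : w = (- v * (1 - q)^-1)%R.
  by rewrite /w -(opprB 1%R q) invrN mulrN mulNr.
rewrite powRrM; apply: ge0_ler_powR; rewrite ?nnegrE ?powR_ge0//.
  by rewrite invr_ge0 ltW.
rewrite -[(1 - q)%R]opprB !powRN lef_pV2 ?posrE ?powR_gt0//.
by apply: n0P; exact: leqW.
Unshelve. all: by end_near. Qed.

End LocalDimensionBounds.

(** * Order and limits in the extended reals *)

Section RationalApproximation.
Context {R : realType}.
Implicit Types x y : \bar R.

Lemma ereal_dense x y : x < y -> exists r : R, x < r%:E < y.
Proof.
case: x y => [a| |] [b| |] //; rewrite ?lte_fin => ab.
- by exists ((a + b) / 2)%R; rewrite !lte_fin !midf_lt.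
- by exists (a + 1)%R; rewrite lte_fin ltrDl ltr01 ltry.
- by exists (b - 1)%R; rewrite lte_fin ltrBlDr ltrDl ltr01 ltNyr.
- by exists 0%R; rewrite ltry ltNyr.
Qed.

Lemma ereal_rat_dense x y : x < y -> exists v : rat, x < (ratr v : R)%:E < y.
Proof.
move=> /ereal_dense[r /andP[xr /ereal_dense[s]]]; rewrite lte_fin => /andP[rs sy].
have [v] := rat_in_itvoo rs; rewrite in_itv/= => /andP[rv vs]; exists v.
by rewrite (lt_trans xr) ?lte_fin//= (lt_trans _ sy)// lte_fin.
Qed.

Lemma le_of_rat x y :
  (forall v : rat, (ratr v : R)%:E < x -> (ratr v : R)%:E <= y) -> x <= y.
Proof.
move=> h; rewrite leNgt; apply/negP => /ereal_rat_dense[v /andP[yv vx]].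
by have := lt_le_trans yv (h v vx); rewrite ltxx.
Qed.

Lemma nonincreasing_at_left_cvge (f : R -> \bar R) (a : R) :
  (forall s t : R, (s <= t)%R -> (t < a)%R -> f t <= f s) ->
  f x @[x --> a^'-] --> ereal_inf (f @` [set t : R | (t < a)%R]).
Proof.
move=> fa; apply/cvg_at_leftNP.
have h := @nondecreasing_at_right_cvge R (f \o -%R) (- a)%R (BInfty _ false).
have -> : f @` [set t : R | (t < a)%R] =
    (f \o -%R) @` [set` Interval (BRight (- a)%R) (BInfty _ false)].
  apply/seteqP; split => _ [x /= xa <-].
    by exists (- x)%R; rewrite /= ?opprK// in_itv/= andbT ltrN2.
  by exists (- x)%R => //=; move: xa; rewrite in_itv/= andbT ltrNl.
apply: h => // x y; rewrite !in_itv/= !andbT => ax ay xy.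
by apply: fa; rewrite ?lerN2// ltrNl.
Qed.

End RationalApproximation.

(** * The local spectrum and its monotonicity *)

Section Spectrum.
Context {R : realType} {X : metricType R}
  (mu : {outer_measure set X -> \bar R}) (mu_meas : is_measure mu).
Implicit Types (x : X) (q v r : R) (A : set X).

Lemma tauq_anti q A A' : A `<=` A' -> tauq mu q A' <= tauq mu q A.
Proof.
move=> AA'; apply: le_of_rat => v /lower_exponent_gt vA'.
apply: (@le_lower_exponent _ _ 1%R) => //.
by apply: filterS vA' => d; rewrite mul1r; apply: le_trans; exact: Sq_mono.
Qed.

(** All balls of radius at most [1] centred in [A] lie in one ball. *)
Lemma packing_mass_bounded A : metric_bounded A -> exists2 C : R, (0 < C)%R &
  forall d D, (0 < d < 1)%R -> fpacking (A `&` spt mu) d D ->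
    \sum_(y <- D) mu (cball y d) <= C%:E.
Proof.
move=> [M AM]; have [->|/set0P[x0 Ax0]] := eqVneq A set0.
  exists 1%R => // d [|y D] _ [_ DA _]; first by rewrite big_nil.
  by have [] := DA y (mem_head _ _).
exists (1 + ball_mass mu x0 (M + 1))%R.
  by rewrite ltr_pwDl// fine_ge0// outer_measure_ge0.
move=> d D /andP[d0 d1] [uD DA tD].
apply: (@le_trans _ _ (mu (cball x0 (M + 1)))); last first.
  by rewrite ball_massE// lee_fin lerDr.
apply: sum_disjoint_cball => // z [y /= yD yz]; have [Ay _] := DA y yD.
apply: (le_trans (metric_triangle x0 y z)).
by rewrite lerD// ?AM// (le_trans yz)// ltW.
Qed.

(** Since [packing_mass_bounded] amounts to [tau_1 >= 0], this is concavity of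
    the spectrum between [q] and [1]. *)
Lemma tauq_interpolation q q' th A : metric_bounded A -> (0 < th <= 1)%R ->
  (q' - 1 = th * (q - 1))%R -> tauq mu q A * th%:E <= tauq mu q' A.
Proof.
move=> bA /andP[th0 th1] qq.
rewrite -lee_pdivlMr//; apply: le_of_rat => v /lower_exponent_gt vA.
rewrite lee_pdivlMr// -EFinM.
have [C C0 CP] := packing_mass_bounded bA.
apply: (@le_lower_exponent _ _ (C + 1)%R); first by rewrite addr_gt0.
near=> d.
have d01 : (0 < d < 1)%R by near: d; exact: near_right01.
have d0 : (0 < d)%R by case/andP: d01.
rewrite powRrM; apply: (@Sq_interpolation _ _ _ mu_meas q) => //.
- exact: powR_gt0.
- by rewrite (ltW th0).
- by move=> D; exact: CP.
- by near: d.
Unshelve. all: by end_near. Qed.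

Lemma loc_tauqE q x : loc_tauq mu q x =
  ereal_sup [set tauq mu q (cball x r) | r in [set r : R | (0 < r)%R]].
Proof.
apply: cvg_lim => //.
have -> : [set tauq mu q (cball x r) | r in [set r : R | (0 < r)%R]] =
  (fun r => tauq mu q (cball x r)) @` [set` Interval (BRight 0%R) (BInfty R false)].
  by apply/seteqP; split => _ [r /= r0 <-]; exists r => //=;
    move: r0; rewrite in_itv/= andbT.
apply: nonincreasing_at_right_cvge => // r s _ _ rs.
exact/tauq_anti/le_cball.
Qed.

Lemma tauq_le_loc q x r : (0 < r)%R -> tauq mu q (cball x r) <= loc_tauq mu q x.
Proof. by move=> r0; rewrite loc_tauqE; apply: ereal_sup_ubound; exists r. Qed.

Lemma loc_tauq_gt q v x : v%:E < loc_tauq mu q x ->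
  exists2 r, (0 < r)%R & v%:E < tauq mu q (cball x r).
Proof. by rewrite loc_tauqE => /ereal_sup_gt[_ [r r0 <-]] ?; exists r. Qed.

Lemma loc_tauq_interpolation q q' th x : (0 < th <= 1)%R ->
  (q' - 1 = th * (q - 1))%R -> loc_tauq mu q x * th%:E <= loc_tauq mu q' x.
Proof.
move=> th01 qq; have /andP[th0 _] := th01.
rewrite -lee_pdivlMr//; apply: le_of_rat => v /loc_tauq_gt[r r0 /ltW vr].
rewrite lee_pdivlMr//; apply: le_trans (tauq_le_loc q' x r0).
apply: le_trans (tauq_interpolation (metric_bounded_cball x r) th01 qq).
by apply: lee_wpmul2r => //; rewrite lee_fin ltW.
Qed.

(** For [x] in the support the spectrum vanishes at [1], and the quotient
    [tau_q / (q - 1)] is the slope of a chord of a concave function. *)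
Lemma loc_dimq_anti_gt1 q q' x : (1 < q')%R -> (q' <= q)%R ->
  loc_dimq mu q x <= loc_dimq mu q' x.
Proof.
move=> q'1 qq'; have q1 : (1 < q)%R by exact: lt_le_trans qq'.
have p'0 : (0 < q' - 1)%R by rewrite subr_gt0.
have p0 : (0 < q - 1)%R by rewrite subr_gt0.
(* The weight for which q' is the barycentre of q and 1. *)
pose th := ((q' - 1) / (q - 1))%R.
have th01 : (0 < th <= 1)%R.
  by rewrite divr_gt0//= ler_pdivrMr// mul1r lerD2r.
have qq : (q' - 1 = th * (q - 1))%R by rewrite /th mulfVK// lt0r_neq0.
rewrite /loc_dimq lee_pdivlMr//.
have := loc_tauq_interpolation x th01 qq.
by rewrite /th mulrC EFinM muleA.
Qed.

Lemma loc_dimq_anti_lt1 q q' x : (q' < 1)%R -> (q <= q')%R ->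
  loc_dimq mu q' x <= loc_dimq mu q x.
Proof.
move=> q'1 qq'; have q1 : (q < 1)%R by exact: le_lt_trans q'1.
have p'0 : (q' - 1 < 0)%R by rewrite subr_lt0.
have p0 : (q - 1 < 0)%R by rewrite subr_lt0.
pose th := ((q' - 1) / (q - 1))%R.
have th01 : (0 < th <= 1)%R.
  by rewrite nmulr_rgt0// invr_lt0 p0 ler_ndivrMr//= mul1r lerD2r.
have qq : (q' - 1 = th * (q - 1))%R by rewrite /th mulfVK// ltr0_neq0.
rewrite /loc_dimq lee_ndivrMr//.
have := loc_tauq_interpolation x th01 qq.
by rewrite /th mulrC EFinM muleA.
Qed.

Lemma cvg_loc_dimq_right x : loc_dimq mu q x @[q --> (1%R : R)^'+] -->
  ereal_sup [set loc_dimq mu q x | q in [set q : R | (1 < q)%R]].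
Proof.
have -> : [set loc_dimq mu q x | q in [set q : R | (1 < q)%R]] =
  (fun q => loc_dimq mu q x) @` [set` Interval (BRight 1%R) (BInfty R false)].
  by apply/seteqP; split => _ [r /= r0 <-]; exists r => //=;
    move: r0; rewrite in_itv/= andbT.
apply: nonincreasing_at_right_cvge => // r s; rewrite !in_itv/= !andbT.
by move=> r1 s1 rs; exact: loc_dimq_anti_gt1.
Qed.

Lemma cvg_loc_dimq_left x : loc_dimq mu q x @[q --> (1%R : R)^'-] -->
  ereal_inf [set loc_dimq mu q x | q in [set q : R | (q < 1)%R]].
Proof.
apply: nonincreasing_at_left_cvge => r s rs s1.
exact: loc_dimq_anti_lt1.
Qed.

(** The conclusion of [ae_ball_mass] at all rational levels, stated with the
    local spectrum so that it mentions no set [A]. *)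
Definition regular_point q x := forall v : rat,
  (ratr v : R)%:E < loc_tauq mu q x ->
  \forall n \near \oo, (ball_mass mu x (dyadic n) `^ (q - 1) <= dyadic n `^ ratr v)%R.

(** If [v] is below the local spectrum at [x] then it is below [tauq mu q] on
    some ball around [x], hence on some member of a countable basis, so that
    countably many instances of [ae_ball_mass] suffice. *)
Lemma ae_regular_point q : doubling X ->
  mu [set x | spt mu x /\ ~ regular_point q x] = 0.
Proof.
move=> dbl.
have [B [bB Bx]] := doubling_countable_basis dbl.
pose N (vi : rat * (nat * nat * nat * nat)) :=
  if (ratr vi.1 : R)%:E < tauq mu q (B vi.2) then
    [set x | (B vi.2 `&` spt mu) x /\ ~ \forall n \near \oo,
      (ball_mass mu x (dyadic n) `^ (q - 1) <= dyadic n `^ ratr vi.1)%R]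
  else set0.
apply: (@null_sub _ _ mu _ (\bigcup_vi N vi)); last first.
  apply: null_bigcup_countable => -[v i]; rewrite /N /=.
  by case: ifPn => [vB|_]; [exact: ae_ball_mass|exact: outer_measure0].
move=> x [sx nreg]; apply: contrapT => nN; apply: nreg => v /loc_tauq_gt[r r0 vr].
apply: contrapT => nv; apply: nN.
have [i Bix Bir] := Bx x r r0.
exists (v, i) => //; rewrite /N /= ifT; first by split.
by apply: (lt_le_trans vr); apply: tauq_anti => y /Bir/ltW.
Qed.

Lemma loc_dimq_le_lower q x : (1 < q)%R -> spt mu x -> regular_point q x ->
  loc_dimq mu q x <= lower_dimloc mu x.
Proof.
move=> q1 sx xreg; have p0 : (0 < q - 1)%R by rewrite subr_gt0.
rewrite /loc_dimq lee_pdivrMr//; apply: le_of_rat => v /xreg vx.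
by rewrite -lee_pdivrMr// -EFinM; exact: le_lower_dimloc vx.
Qed.

Lemma upper_le_loc_dimq q x : (q < 1)%R -> spt mu x -> regular_point q x ->
  upper_dimloc mu x <= loc_dimq mu q x.
Proof.
move=> q1 sx xreg; have p0 : (q - 1 < 0)%R by rewrite subr_lt0.
rewrite /loc_dimq lee_ndivlMr//; apply: le_of_rat => v /xreg vx.
by rewrite -lee_ndivlMr// -EFinM; exact: upper_dimloc_le vx.
Qed.

End Spectrum.

Theorem theorem3p1 (R : realType) (X : metricType R)
    (mu : {outer_measure set X -> \bar R}) :
  doubling X -> is_measure mu ->
  mu (~` [set x : X |
    [/\ cvg (loc_dimq mu q x @[q --> (1%R : R)^'+]),
        cvg (loc_dimq mu q x @[q --> (1%R : R)^'-]),
        lim (loc_dimq mu q x @[q --> (1%R : R)^'+]) <= lower_dimloc mu x,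
        lower_dimloc mu x <= upper_dimloc mu x &
        upper_dimloc mu x <= lim (loc_dimq mu q x @[q --> (1%R : R)^'-])]]) = 0.
Proof.
move=> dbl mu_meas.
pose e (k : nat) : R := (k.+1%:R^-1)%R.
have e_lt (a : R) : (0 < a)%R -> exists k, (e k <= a)%R.
  move=> a0; exists (Num.truncn a^-1)%R.
  rewrite /e invf_ple ?posrE ?ltr0n//; apply: ltW; exact: truncnS_gt.
have e0 k : (0 < e k)%R by rewrite invr_gt0 ltr0n.
pose Z q := [set x | spt mu x /\ ~ regular_point mu q x].
have Z0 q : mu (Z q) = 0 by exact: ae_regular_point.
pose N := ~` spt mu `|` \bigcup_k (Z (1 + e k)%R `|` Z (1 - e k)%R).
apply: (@null_sub _ _ mu _ N); last first.
  apply: null_setU; first exact: spt_full_measure.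
  by apply: null_bigcup_countable => k; apply: null_setU; exact: Z0.
move=> x; apply: contra_notP => nN.
have sx : spt mu x by apply: contrapT => nsx; apply: nN; left.
have reg_r k : regular_point mu (1 + e k)%R x.
  by apply: contrapT => h; apply: nN; right; exists k => //; left.
have reg_l k : regular_point mu (1 - e k)%R x.
  by apply: contrapT => h; apply: nN; right; exists k => //; right.
have cr := @cvg_loc_dimq_right _ _ _ mu_meas x.
have cl := @cvg_loc_dimq_left _ _ _ mu_meas x.
split.
- exact: cvgP cr.
- exact: cvgP cl.
- rewrite (cvg_lim _ cr)//; apply: ge_ereal_sup => _ [q q1 <-].
  have [|k kq] := e_lt (q - 1)%R; first by rewrite subr_gt0.
  apply: le_trans (loc_dimq_le_lower mu_meas _ sx (reg_r k)); last first.
    by rewrite ltrDl.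
  by apply: loc_dimq_anti_gt1; rewrite ?ltrDl// -lerBrDl.
- exact: le_lower_upper_exponent.
- rewrite (cvg_lim _ cl)//; apply: le_ereal_inf_tmp => _ [q q1 <-].
  have [|k kq] := e_lt (1 - q)%R; first by rewrite subr_gt0.
  apply: (le_trans (upper_le_loc_dimq mu_meas _ sx (reg_l k))).
    by rewrite ltrBlDr ltrDl.
  by apply: loc_dimq_anti_lt1; rewrite ?ltrBlDr ?ltrDl// lerBrDr -lerBrDl.
Qed.
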